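(* For an American option $\xi$ and $j\in\{1,\ldots,d\}$, \[ \pi^{\mathrm{bg}}_j(\xi)=\max_{\chi\in\mathcal{X}}\ \min_{(\mathbb{Q},S)\in\bar{\mathcal{P}}_j}\mathbb{E}_{\mathbb{Q}}\big((\xi\cdot S)_\chi\big), \] and there exist $\hat\chi\in\mathcal{X}$ and $(\hat{\mathbb{Q}},\hat S)\in\bar{\mathcal{P}}_j$ such that \[ \pi^{\mathrm{bg}}_j(\xi)=\mathbb{E}_{\hat{\mathbb{Q}}}\big((\xi\cdot\hat S)_{\hat\chi}\big)=\min_{(\mathbb{Q},S)\in\bar{\mathcal{P}}_j}\mathbb{E}_{\mathbb{Q}}\big((\xi\cdot S)_{\hat\chi}\big). \]
   Context: Finite filtered probability space $(\Omega,\mathcal{F},\mathbb{P};(\mathcal{F}_t)_{t=0}^T)$, $\mathcal{F}_0$ trivial, $\mathcal{F}_T=2^\Omega$, $\mathbb{P}(\{\omega\})>0$. $\Omega_t$: atoms of $\mathcal{F}_t$. $\mathcal{L}_t$: $\mathcal{F}_t$-measurable $\mathbb{R}^d$-valued random variables. $d$ assets, $\mathcal{F}_t$-measurable exchange rates $\pi^{jk}_t>0$, $\pi^{jj}_t=1$. $\mathcal{K}^\mu_t$ ($\mu\in\Omega_t$): convex cone generated by $e^1,\ldots,e^d$ and $\pi^{jk}_t(\mu)e^j-e^k$; $\mathcal{K}_t=\{x\in\mathcal{L}_t:x(\mu)\in\mathcal{K}^\mu_t\ \forall\mu\}$. For a cone $A$, $A^\ast=\{y:y\cdot x\ge0\ \forall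 x\in A\}$; ''$S_t\in\mathcal{K}^\ast_t\setminus\{0\}$'' means $S_t(\mu)\in(\mathcal{K}^\mu_t)^\ast\setminus\{0\}$ for all $\mu\in\Omega_t$. Trading strategies $\Phi$: $y_0\in\mathbb{R}^d$, $y_t\in\mathcal{L}_{t-1}$, $y_{T+1}=0$. Mixed stopping times $\mathcal{X}$: adapted $[0,1]$-valued $\chi$ with $\sum_t\chi_t=1$. $(\xi\cdot S)_\chi=\sum_{t=0}^T\chi_t\,\xi_t\cdot S_t$. American option: adapted $\mathbb{R}^d$-valued $\xi$. $\Phi^{\mathrm{bg}}(\xi)$: pairs $(y,\chi)\in\Phi\times\mathcal{X}$ with $y_t+\chi_t\xi_t-y_{t+1}\in\mathcal{K}_t$ for $t=0,\ldots,T$. $\pi^{\mathrm{bg}}_j(\xi)=\sup\{-x\in\mathbb{R}:\exists(y,\chi)\in\Phi^{\mathrm{bg}}(\xi),\ xe^j=y_0\}$. $\bar{\mathcal{P}}_j$: the set of pairs $(\mathbb{Q},S)$ where $\mathbb{Q}$ is a probability measure on $\Omega$ absolutely continuous with respect to $\mathbb{P}$ and $S=(S_t)_{t=0}^T$ is an $\mathbb{R}^d$-valued $\mathbb{Q}$-martingale with $S_t\in\mathcal{K}^\ast_t\setminus\{0\}$ and $S^j_t=1$ for all $t$. Standing assumption: no arbitrage (no $y\in\Phi$ with $y_0=0$, $y_t-y_{t+1}\in\mathcal{K}_t$ for $t<T$ and $y_T-x\in\mathcal{K}_T$ for a nonzero componentwise non-negative $x\in\mathcal{L}_T$). *)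

(* Defs.v *)
From HB Require Import structures.
From mathcomp Require Import all_boot all_order all_algebra.
From mathcomp Require Import classical_sets reals constructive_ereal ereal.
Set Implicit Arguments. Unset Strict Implicit. Unset Printing Implicit Defensive.
Import Order.TTheory GRing.Theory Num.Theory.
Local Open Scope ring_scope.
Local Open Scope classical_set_scope.

Section Defs.
Variables (R : realType) (Omega : finType) (T d : nat).

(* The filtration (F_t)_{t=0..T} is encoded by the equivalence relations
   "w and w' lie in the same atom of F_t" : eqv t w w'. *)
Definition filtration (eqv : nat -> rel Omega) : Prop :=
  [/\ (forall t, (t <= T)%N -> forall w, eqv t w w) /\
      (forall t, (t <= T)%N -> forall w w', eqv t w w' -> eqv t w' w),
      (forall t, (t <= T)%N -> forall w w' w'', eqv t w w' -> eqv t w' w'' -> eqv t w w''),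
      (forall w w', eqv 0%N w w')                       (* F_0 trivial *),
      (forall w w', eqv T w w' -> w = w')               (* F_T = 2^Omega *) &
      (forall t, (t < T)%N -> forall w w', eqv t.+1 w w' -> eqv t w w') (* increasing *)].

Definition measurable_t {A : Type} (eqv : nat -> rel Omega) (t : nat) (X : Omega -> A) :=
  forall w w', eqv t w w' -> X w = X w'.

Definition full_prob (P : Omega -> R) : Prop :=
  (forall w, 0 < P w) /\ \sum_w P w = 1.

Definition exch_rates (eqv : nat -> rel Omega) (pi : nat -> Omega -> 'I_d -> 'I_d -> R) :=
  forall t, (t <= T)%N ->
    [/\ measurable_t eqv t (pi t),
        (forall w j k, 0 < pi t w j k) &
        (forall w j, pi t w j j = 1)].

Definition dotv (x y : 'I_d -> R) : R := \sum_i x i * y i.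

(* x lies in the convex cone generated by e^1..e^d and pi^{jk} e^j - e^k *)
Definition inK (pi : nat -> Omega -> 'I_d -> 'I_d -> R) (t : nat) (w : Omega)
    (x : 'I_d -> R) : Prop :=
  exists (a : 'I_d -> R) (b : 'I_d -> 'I_d -> R),
    [/\ (forall i, 0 <= a i), (forall j k, 0 <= b j k) &
        (forall i, x i = a i + \sum_k b i k * pi t w i k - \sum_k b k i)].

Definition inKt (eqv : nat -> rel Omega) (pi : nat -> Omega -> 'I_d -> 'I_d -> R)
    (t : nat) (x : Omega -> 'I_d -> R) : Prop :=
  measurable_t eqv t x /\ forall w, inK pi t w (x w).

Definition inKdual_nz (pi : nat -> Omega -> 'I_d -> 'I_d -> R) (t : nat) (w : Omega)
    (y : 'I_d -> R) : Prop :=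
  (forall x, inK pi t w x -> 0 <= dotv y x) /\ exists i, y i != 0.

Definition strategy (eqv : nat -> rel Omega) (y : nat -> Omega -> 'I_d -> R) : Prop :=
  [/\ (forall w w', y 0%N w = y 0%N w'),
      (forall t, (1 <= t <= T)%N -> measurable_t eqv t.-1 (y t)) &
      (forall w, y T.+1 w = (fun _ => 0))].

Definition mixed_stop (eqv : nat -> rel Omega) (chi : nat -> Omega -> R) : Prop :=
  [/\ (forall t, (t <= T)%N -> measurable_t eqv t (chi t)),
      (forall t w, (t <= T)%N -> 0 <= chi t w <= 1) &
      (forall w, \sum_(t < T.+1) chi t w = 1)].

Definition american (eqv : nat -> rel Omega) (xi : nat -> Omega -> 'I_d -> R) : Prop :=
  forall t, (t <= T)%N -> measurable_t eqv t (xi t).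

Definition Phi_bg (eqv : nat -> rel Omega) (pi : nat -> Omega -> 'I_d -> 'I_d -> R)
    (xi : nat -> Omega -> 'I_d -> R) (y : nat -> Omega -> 'I_d -> R)
    (chi : nat -> Omega -> R) : Prop :=
  [/\ strategy eqv y, mixed_stop eqv chi &
      forall t, (t <= T)%N ->
        inKt eqv pi t (fun w i => y t w i + chi t w * xi t w i - y t.+1 w i)].

Definition pi_bg (eqv : nat -> rel Omega) (pi : nat -> Omega -> 'I_d -> 'I_d -> R)
    (xi : nat -> Omega -> 'I_d -> R) (j : 'I_d) : \bar R :=
  ereal_sup [set v : \bar R | exists (x : R) y chi,
     [/\ Phi_bg eqv pi xi y chi,
         (forall w i, y 0%N w i = if i == j then x else 0) &
         v = (- x)%:E]].

Definition no_arbitrage (eqv : nat -> rel Omega) (pi : nat -> Omega -> 'I_d -> 'I_d -> R) :=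
  ~ exists (y : nat -> Omega -> 'I_d -> R) (x : Omega -> 'I_d -> R),
    [/\ strategy eqv y /\ (forall w i, y 0%N w i = 0),
        (forall t, (t < T)%N -> inKt eqv pi t (fun w i => y t w i - y t.+1 w i)),
        (forall w i, 0 <= x w i),
        (exists w i, x w i != 0) &
        inKt eqv pi T (fun w i => y T w i - x w i)].

(* Q-martingale w.r.t. the filtration: E_Q[S_{t+1} | F_t] = S_t, written
   atomwise (this is the standard meaning also on Q-null atoms). *)
Definition martingale (eqv : nat -> rel Omega) (Q : Omega -> R)
    (S : nat -> Omega -> 'I_d -> R) : Prop :=
  (forall t, (t <= T)%N -> measurable_t eqv t (S t)) /\
  forall t w i, (t < T)%N ->
    \sum_(w' | eqv t w w') Q w' * S t.+1 w' i = (\sum_(w' | eqv t w w') Q w') * S t w i.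

Definition Pbar (eqv : nat -> rel Omega) (P : Omega -> R)
    (pi : nat -> Omega -> 'I_d -> 'I_d -> R) (j : 'I_d)
    (Q : Omega -> R) (S : nat -> Omega -> 'I_d -> R) : Prop :=
  [/\ (forall w, 0 <= Q w) /\ \sum_w Q w = 1,
      (forall w, P w = 0 -> Q w = 0),
      martingale eqv Q S,
      (forall t w, (t <= T)%N -> inKdual_nz pi t w (S t w)) &
      (forall t w, (t <= T)%N -> S t w j = 1)].

Definition expQ (Q : Omega -> R) (xi S : nat -> Omega -> 'I_d -> R)
    (chi : nat -> Omega -> R) : R :=
  \sum_w Q w * \sum_(t < T.+1) chi t w * dotv (xi t w) (S t w).

End Defs.

(* Main.v *)
Require Import Defs.
From HB Require Import structures.
From mathcomp Require Import all_boot all_order all_algebra.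
From mathcomp Require Import ring.
From mathcomp Require Import boolp classical_sets reals constructive_ereal ereal.
Import Order.TTheory GRing.Theory Num.Theory.
Local Open Scope ring_scope.
Local Open Scope classical_set_scope.

(* Eliminating the trading strategy, [(y, chi)] superhedges the buyer's position
   at price [m] iff [sum_t chi_t xi_t - m e^j], as an element of R^(Omega x d),
   lies in the convex cone spanned by the processes in the [K_t]; this cone is
   finitely generated.  The elements [z] of the dual cone with [z . e^j = 1]
   are the terminal values [z = Q S_T] of the pairs in Pbar_j, and
   [E_Q((xi . S)_chi)] is the pairing of [z] with [sum_t chi_t xi_t].  For fixed
   [chi], Farkas' lemma gives strong duality with attainment on both sides.
   Adding [chi] itself to the generators, with extra coordinates recording
   [sum_t chi_t = 1], the same argument shows that the supremum over [chi] is
   attained, so no minimax theorem is needed. *)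

(** * Finitely generated cones, Farkas' lemma and linear programming duality *)

Section Cones.
Context {R : realType}.

Definition dot {X : finType} (z v : X -> R) : R := \sum_x z x * v x.

Definition cone {C X : finType} (g : C -> X -> R) (v : X -> R) : Prop :=
  exists2 lam : C -> R, (forall c, 0 <= lam c) &
    forall x, v x = \sum_c lam c * g c x.

Definition dual {C X : finType} (g : C -> X -> R) (z : X -> R) : Prop :=
  forall c, 0 <= dot z (g c).

Lemma eq_dot {X : finType} (z z' v v' : X -> R) :
  z =1 z' -> v =1 v' -> dot z v = dot z' v'.
Proof. by move=> ez ev; apply: eq_bigr => x _; rewrite ez ev. Qed.

Lemma dotC {X : finType} (z v : X -> R) : dot z v = dot v z.
Proof. by apply: eq_bigr => x _; rewrite mulrC. Qed.

Lemma dotDZr {X : finType} (z v u : X -> R) a :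
  dot z (fun x => v x + a * u x) = dot z v + a * dot z u.
Proof.
by rewrite mulr_sumr -big_split; apply: eq_bigr => x _ /=; rewrite mulrDr mulrCA.
Qed.

Lemma dotDZl {X : finType} (z z' v : X -> R) a :
  dot (fun x => z x + a * z' x) v = dot z v + a * dot z' v.
Proof.
by rewrite mulr_sumr -big_split; apply: eq_bigr => x _ /=; rewrite mulrDl mulrA.
Qed.

Lemma dotZl {X : finType} (z v : X -> R) a :
  dot (fun x => a * z x) v = a * dot z v.
Proof. by rewrite mulr_sumr; apply: eq_bigr => x _; rewrite mulrA. Qed.

Lemma dot_sumr {C X : finType} (z : X -> R) (lam : C -> R) (g : C -> X -> R) :
  dot z (fun x => \sum_c lam c * g c x) = \sum_c lam c * dot z (g c).
Proof.
rewrite /dot; under eq_bigr do rewrite mulr_sumr.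
rewrite exchange_big; apply: eq_bigr => c _; rewrite mulr_sumr.
by apply: eq_bigr => x _; rewrite mulrCA.
Qed.

Lemma dot_cone_ge0 {C X : finType} (g : C -> X -> R) z v :
  dual g z -> cone g v -> 0 <= dot z v.
Proof.
move=> zg [lam lam0 vE].
rewrite (eq_dot _ z _ (fun x => \sum_c lam c * g c x)) // dot_sumr.
by apply: sumr_ge0 => c _; rewrite mulr_ge0.
Qed.

(* Induction on the generators (Bartl): if [z] separates [v] from all of them
   but [g c0], projecting along [g c0] onto the hyperplane [dot z = 0] removes
   [g c0] from the list. *)
Lemma farkas_seq {C X : finType} (r : seq C) (g : C -> X -> R) (v : X -> R) :
  uniq r ->
  (exists2 lam : C -> R, (forall c, 0 <= lam c) &
     forall x, v x = \sum_(c <- r) lam c * g c x) \/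
  (exists2 z : X -> R, (forall c, c \in r -> 0 <= dot z (g c)) & dot z v < 0).
Proof.
elim: r g v => [|c0 r IH] g v /=.
  move=> _; have [/existsP [x vx]|] := boolP [exists x, v x != 0]; last first.
    rewrite negb_exists => /forallP v0; left; exists (fun=> 0) => // x.
    by rewrite big_nil; apply/eqP; have := v0 x; rewrite negbK.
  right; exists (fun x => - v x) => //.
  rewrite /dot (bigD1 x) //= mulNr -expr2.
  apply: ltr_wnDr; last by rewrite oppr_lt0 lt0r sqrf_eq0 vx sqr_ge0.
  by apply: sumr_le0 => y _; rewrite mulNr -expr2 oppr_le0 sqr_ge0.
case/andP=> c0r ur; have [[lam lam0 vE]|[z zg zv]] := IH g v ur.
  left; exists (fun c => if c == c0 then 0 else lam c) => [c|x].
    by case: ifP.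
  rewrite big_cons eqxx mul0r add0r vE; apply: eq_big_seq => c cr.
  by rewrite ifN //; apply: contraNneq c0r => <-.
have [z0|z0] := leP 0 (dot z (g c0)).
  by right; exists z => // c; rewrite in_cons => /orP[/eqP->|/zg].
have al0 : dot z (g c0) != 0 by rewrite lt_eqF.
set al := dot z (g c0) in z0 al0.
have := IH (fun c x => g c x + (- (dot z (g c) / al)) * g c0 x)
           (fun x => v x + (- (dot z v / al)) * g c0 x) ur.
case=> [[lam lam0 vE]|[z' zg' zv']].
  (* Undoing the projection forces this weight on [g c0]. It is nonnegative because [al] and
     [dot z v] are negative while every [dot z (g c)] is nonnegative. *)
  pose b := dot z v / al - \sum_(c <- r) lam c * (dot z (g c) / al).
  left; exists (fun c => if c == c0 then b else lam c) => [c|x].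
    case: ifP => // _; rewrite subr_ge0; apply: (@le_trans _ _ 0).
      rewrite big_seq; apply: sumr_le0 => c' /zg gc'.
      by rewrite mulr_ge0_le0 // mulr_ge0_le0 // invr_le0 ltW.
    by rewrite mulr_le0 // ?invr_le0 ltW.
  have := vE x; move/eqP; rewrite mulNr subr_eq => /eqP ->.
  rewrite big_cons eqxx /b mulrBl addrC -addrA; congr (_ + _).
  have -> : \sum_(c <- r) (if c == c0 then b else lam c) * g c x =
            \sum_(c <- r) lam c * g c x.
    apply: eq_big_seq => c cr; rewrite ifN //.
    by apply: contraNneq c0r => <-.
  rewrite mulr_suml -sumrN -big_split; apply: eq_bigr => c _ /=; ring.
(* The correction by [z] makes the functional vanish on [g c0]; on any vector it acts as [z'] does
   on the projected vector. *)
right; exists (fun x => z' x + (- (dot z' (g c0) / al)) * z x).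
  move=> c; rewrite dotDZl in_cons => /orP[/eqP->|cr].
    by rewrite -/al mulNr divfK // subrr.
  have := zg' c cr; rewrite dotDZr; congr (_ <= _); ring.
by rewrite dotDZl; move: zv'; rewrite dotDZr; congr (_ < _); ring.
Qed.

Lemma farkas {C X : finType} (g : C -> X -> R) (v : X -> R) :
  cone g v \/ exists2 z, dual g z & dot z v < 0.
Proof.
have [[lam lam0 vE]|[z zg zv]] := farkas_seq (index_enum C) g v (index_enum_uniq C).
  by left; exists lam.
by right; exists z => // c; apply: zg; rewrite mem_index_enum.
Qed.

(** If the supremum of the feasible [m] were infeasible, a separating [z] would have [dot z e > 0],
    and [dot z v / dot z e] would bound all feasible [m] by a value below their supremum. *)
Lemma cone_max {C X : finType} (g : C -> X -> R) (v e : X -> R) m0 B :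
  cone g (fun x => v x - m0 * e x) ->
  (forall m, cone g (fun x => v x - m * e x) -> m <= B) ->
  exists2 M, cone g (fun x => v x - M * e x) &
    forall m, cone g (fun x => v x - m * e x) -> m <= M.
Proof.
move=> gm0 gB; pose E := [set m | cone g (fun x => v x - m * e x)].
have supE : has_sup E by split; [exists m0 | exists B => m /gB].
have ubE m : E m -> m <= sup E by apply: sup_upper_bound.
exists (sup E) => //.
have [//|[z zg]] := farkas g (fun x => v x - sup E * e x).
have dotE m : dot z (fun x => v x - m * e x) = dot z v - m * dot z e.
  rewrite -mulNr -dotDZr; apply: eq_dot => // x; by rewrite mulNr.
rewrite dotE subr_lt0 => zv.
have dotm m : E m -> m * dot z e <= dot z v.
  by move=> /(dot_cone_ge0 _ _ _ zg); rewrite dotE subr_ge0.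
(* The pairing is nonnegative at [m0], negative at [sup E], and [m0 <= sup E]; being affine in [m]
   with slope [- dot z e], it must decrease. *)
have ze : 0 < dot z e.
  have := le_lt_trans (dotm _ gm0) zv; rewrite -subr_gt0 -mulrBl => h.
  rewrite lt_neqAle; apply/andP; split.
    by apply: contraTneq h => <-; rewrite mulr0 ltxx.
  rewrite leNgt; apply/negP => ze; move: h; apply/negP; rewrite -leNgt.
  by rewrite mulr_ge0_le0 ?subr_ge0 ?ubE // ltW.
have : sup E <= dot z v / dot z e.
  by apply: ge_sup; [exists m0 | move=> m /dotm; rewrite ler_pdivlMr].
by rewrite ler_pdivlMr // leNgt zv.
Qed.

(** Farkas' lemma is applied to [- e], with [M e - v] added to the generators. Membership would
    contradict the maximality of [M]; a separating [z], scaled to [dot z e = 1], is the dual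
    optimiser. *)
Lemma cone_max_dual {C X : finType} (g : C -> X -> R) (v e : X -> R) M :
  cone g (fun x => v x - M * e x) ->
  (forall m, cone g (fun x => v x - m * e x) -> m <= M) ->
  exists2 z, dual g z & dot z e = 1 /\ dot z v <= M.
Proof.
move=> gM maxM.
pose g' (o : C + 'I_1) :=
  if o is inl c then g c else fun x => M * e x + (-1) * v x.
have [[lam lam0 eE]|[z zg' ze]] := farkas g' (fun x => - e x).
  have lamS x : - e x = lam (inr ord0) * (M * e x - v x) + \sum_c lam (inl c) * g c x.
    by rewrite eE big_sumType big_ord1 /= mulN1r addrC.
  (* Weight zero puts [- e] in the cone of [g], so [M + 1] would be feasible; a nonzero weight can
     be divided out and makes [M] plus its inverse feasible. *)
  have [l0|l0] := eqVneq (lam (inr ord0)) 0.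
    case: gM => mu mu0 muE.
    suff /maxM : cone g (fun x => v x - (M + 1) * e x) by rewrite gerDl ler10.
    exists (fun c => mu c + lam (inl c)) => [c|x]; first by rewrite addr_ge0.
    under eq_bigr do rewrite mulrDl.
    by rewrite big_split -muE /=; have := lamS x; rewrite l0 mul0r add0r => <-; ring.
  have lp : 0 < lam (inr ord0) by rewrite lt0r l0 lam0.
  suff /maxM : cone g (fun x => v x - (M + (lam (inr ord0))^-1) * e x).
    by rewrite gerDl leNgt invr_gt0 lp.
  exists (fun c => (lam (inr ord0))^-1 * lam (inl c)) => [c|x].
    by rewrite mulr_ge0 // invr_ge0.
  under eq_bigr do rewrite -mulrA.
  rewrite -mulr_sumr.
  have -> : \sum_c lam (inl c) * g c x = - e x - lam (inr ord0) * (M * e x - v x).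
    by rewrite lamS addrC addKr.
  by field.
have {}ze : 0 < dot z e.
  move: ze; rewrite -[ltRHS]oppr0 ltrNr; congr (_ < _).
  by rewrite -sumrN; apply: eq_bigr => x _; rewrite mulrN opprK.
exists (fun x => (dot z e)^-1 * z x).
  move=> c; rewrite dotZl; apply: mulr_ge0; first by rewrite invr_ge0 ltW.
  exact: (zg' (inl c)).
rewrite !dotZl mulVf ?gt_eqF //; split=> //.
rewrite mulrC ler_pdivrMr // -[_ <= _]subr_ge0.
have := zg' (inr ord0); rewrite dotDZr mulN1r.
have -> : dot z (fun x => M * e x) = M * dot z e.
  by rewrite mulr_sumr; apply: eq_bigr => x _; rewrite mulrCA.
by [].
Qed.

End Cones.

(** * Solvency cones and their dual price vectors *)

Section SolvencyCone.
Context {R : realType} {Omega : finType} {d : nat}.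
Variable pi : nat -> Omega -> 'I_d -> 'I_d -> R.
Variables (t : nat) (w : Omega).

Local Notation inK := (inK pi t w).

Definition gvec (c : 'I_d + 'I_d * 'I_d) : 'I_d -> R :=
  match c with
  | inl i => fun l => (l == i)%:R
  | inr (j, k) => fun l => pi t w j k * (l == j)%:R - (l == k)%:R
  end.

(** The dual of the solvency cone, zero included, as a finite list of inequalities, one for each
    generator. *)
Definition price_vec (y : 'I_d -> R) : Prop :=
  (forall i, 0 <= y i) /\ forall j k, y k <= pi t w j k * y j.

Lemma eq_inK x y : x =1 y -> inK x -> inK y.
Proof. by move=> xy [a [b [a0 b0 xE]]]; exists a, b; split=> // i; rewrite -xy. Qed.

Lemma inK0 : inK (fun=> 0).
Proof.
exists (fun=> 0), (fun _ _ => 0); split=> // i.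
by rewrite !big1 ?addr0 ?subr0 // => k _; rewrite mul0r.
Qed.

Lemma inKD x y : inK x -> inK y -> inK (fun i => x i + y i).
Proof.
move=> [a [b [a0 b0 xE]]] [a' [b' [a'0 b'0 yE]]].
exists (fun i => a i + a' i), (fun i k => b i k + b' i k).
split=> [i|j k|i]; rewrite ?addr_ge0 // xE yE big_split /=.
under [in RHS]eq_bigr do rewrite mulrDl.
by rewrite big_split /=; ring.
Qed.

Lemma inKZ r x : 0 <= r -> inK x -> inK (fun i => r * x i).
Proof.
move=> r0 [a [b [a0 b0 xE]]].
exists (fun i => r * a i), (fun i k => r * b i k).
split=> [i|j k|i]; rewrite ?mulr_ge0 // xE mulrBr mulrDr !mulr_sumr.
by under eq_bigr do rewrite mulrA.
Qed.

Lemma inK_sum {I : Type} (s : seq I) (Q : pred I) (x : I -> 'I_d -> R) :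
  (forall i, Q i -> inK (x i)) -> inK (fun k => \sum_(i <- s | Q i) x i k).
Proof.
move=> xK; elim: s => [|i s IH].
  by apply: eq_inK inK0 => k; rewrite big_nil.
have [Qi|Qi] := boolP (Q i).
  by apply: eq_inK (inKD _ _ (xK i Qi) IH) => k; rewrite big_cons Qi.
by apply: eq_inK IH => k; rewrite big_cons (negbTE Qi).
Qed.

Lemma gvec_inK c : inK (gvec c).
Proof.
case: c => [i|[j k]] /=.
  exists (fun l => (l == i)%:R), (fun _ _ => 0); split=> // l.
  by rewrite !big1 ?addr0 ?subr0 // => m _; rewrite mul0r.
exists (fun=> 0), (fun j' k' => ((j' == j) && (k' == k))%:R); split=> // l.
rewrite add0r; congr (_ - _).
  rewrite (bigD1 k) //= eqxx andbT big1 ?addr0; last first.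
    by move=> m /negbTE ->; rewrite andbF mul0r.
  by case: eqP => [->|]; rewrite ?mulr1 ?mul1r // mulr0 mul0r.
rewrite (bigD1 j) //= eqxx big1 ?addr0 // => m /negbTE ->; by [].
Qed.

Lemma dotv_delta (y : 'I_d -> R) i : dotv y (fun l => (l == i)%:R) = y i.
Proof.
rewrite /dotv (bigD1 i) //= eqxx mulr1 big1 ?addr0 // => m /negbTE ->.
by rewrite mulr0.
Qed.

Lemma dotv_transfer (y : 'I_d -> R) j k :
  dotv y (gvec (inr (j, k))) = pi t w j k * y j - y k.
Proof.
rewrite -(dotv_delta y j) -(dotv_delta y k) /dotv mulr_sumr -sumrB.
by apply: eq_bigr => l _ /=; ring.
Qed.

Lemma price_vec_gvec y : (forall c, 0 <= dotv y (gvec c)) <-> price_vec y.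
Proof.
split=> [y0|[y0 yp] [i|[j k]]].
- split=> [i|j k]; first by have := y0 (inl i); rewrite /= dotv_delta.
  by have := y0 (inr (j, k)); rewrite dotv_transfer subr_ge0.
- by rewrite /= dotv_delta.
- by rewrite dotv_transfer subr_ge0.
Qed.

Lemma price_vecP y : price_vec y <-> forall x, inK x -> 0 <= dotv y x.
Proof.
split=> [[y0 yp] x [a [b [a0 b0 xE]]]|yK]; last first.
  by apply/price_vec_gvec => c; apply: yK; apply: gvec_inK.
suff -> : dotv y x = \sum_i y i * a i
    + \sum_j \sum_k b j k * (pi t w j k * y j - y k).
  apply: addr_ge0; first by apply: sumr_ge0 => i _; rewrite mulr_ge0.
  by do 2!apply: sumr_ge0 => ? _; rewrite mulr_ge0 // subr_ge0.
under [X in _ = _ + X]eq_bigr do under eq_bigr do rewrite mulrBr.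
under [X in _ = _ + X]eq_bigr do rewrite sumrB.
rewrite sumrB [X in _ + (_ - X)]exchange_big -sumrB -big_split /=.
apply: eq_bigr => i _; rewrite xE -addrA mulrDr mulrBr !mulr_sumr.
by congr (_ + (_ - _)); apply: eq_bigr => k _; ring.
Qed.

Lemma price_vecZ r y : 0 <= r -> price_vec y -> price_vec (fun i => r * y i).
Proof.
move=> r0 [y0 yp]; split=> [i|j k]; first by rewrite mulr_ge0.
by rewrite mulrCA ler_wpM2l.
Qed.

Lemma price_vec0 y j : price_vec y -> y j = 0 -> forall i, y i = 0.
Proof.
move=> [y0 yp] yj i; apply/eqP; rewrite eq_le y0 andbT.
by have := yp j i; rewrite yj mulr0.
Qed.

End SolvencyCone.

(** * Atoms of the filtration and sums over them *)

Section Filtration.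
Context {R : realType} {Omega : finType}.
Variables (T : nat) (eqv : nat -> rel Omega).
Hypothesis filt : filtration T eqv.

Lemma eqv_refl t w : (t <= T)%N -> eqv t w w.
Proof. by case: filt => -[h _] _ _ _ _ tT; apply: h. Qed.

Lemma eqv_sym t w w' : (t <= T)%N -> eqv t w w' = eqv t w' w.
Proof. by case: filt => -[_ h] _ _ _ _ tT; apply/idP/idP; apply: h. Qed.

Lemma eqv_left t w w' : (t <= T)%N -> eqv t w w' -> eqv t w =1 eqv t w'.
Proof.
case: (filt) => _ tr _ _ _ tT ww' w''; apply/idP/idP; last exact: tr.
by apply: tr => //; rewrite eqv_sym.
Qed.

Lemma eqvT w w' : eqv T w w' = (w == w').
Proof.
apply/idP/eqP => [|->]; last exact: eqv_refl.
by case: filt => _ _ _ h _; apply: h.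
Qed.

Lemma eqv0 w w' : eqv 0%N w w'.
Proof. by case: filt. Qed.

Lemma eqv_le s t w w' : (s <= t <= T)%N -> eqv t w w' -> eqv s w w'.
Proof.
case/andP=> + tT; elim: t tT => [|t IH] tT; first by rewrite leqn0 => /eqP->.
rewrite leq_eqVlt => /orP[/eqP->//|st] ww'; apply: IH => //; first exact: ltnW.
by case: filt => _ _ _ _ h; apply: h.
Qed.

(** An unnormalised conditional expectation: sums in place of averages avoid division on null
    atoms. *)
Definition atom_sum t (f : Omega -> R) w := \sum_(w' | eqv t w w') f w'.

Lemma atom_sum_meas t f : (t <= T)%N -> measurable_t eqv t (atom_sum t f).
Proof. by move=> tT w w' ww'; apply: eq_bigl => u; apply: eqv_left. Qed.

Lemma atom_sumT f w : atom_sum T f w = f w.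
Proof.
rewrite /atom_sum (eq_bigl (pred1 w)) ?big_pred1_eq // => u.
by rewrite eqvT eq_sym.
Qed.

Lemma atom_sum0 f w : atom_sum 0%N f w = \sum_w f w.
Proof. by apply: eq_bigl => u; rewrite eqv0. Qed.

Lemma atom_sum_ge0 t f w : (forall w, 0 <= f w) -> 0 <= atom_sum t f w.
Proof. by move=> f0; apply: sumr_ge0. Qed.

Lemma atom_sum1_gt0 t w : (t <= T)%N -> 0 < atom_sum t (fun=> 1) w.
Proof.
move=> tT; rewrite /atom_sum (bigD1 w) ?eqv_refl //=.
by apply: ltr_pwDl => //; apply: sumr_ge0.
Qed.

Lemma atom_sum_measM t f X w : measurable_t eqv t X ->
  atom_sum t (fun w => f w * X w) w = atom_sum t f w * X w.
Proof.
by move=> mX; rewrite mulr_suml; apply: eq_bigr => u /mX ->.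
Qed.

(** Conditioning under the counting measure: [atom_sum t (fun=> 1) w] is the size of the atom of
    [w], so the quotient is the average of [f] there. The proof is double counting. *)
Lemma sum_atoms t (X f : Omega -> R) : (t <= T)%N -> measurable_t eqv t X ->
  \sum_w X w * f w = \sum_w X w * (atom_sum t f w / atom_sum t (fun=> 1) w).
Proof.
move=> tT mX; pose n := atom_sum t (fun=> 1).
transitivity (\sum_w \sum_(w' | eqv t w w') X w / n w * f w'); last first.
  by apply: eq_bigr => w _; rewrite -mulr_sumr -/(atom_sum t f w) -/n; ring.
rewrite (exchange_big_dep predT) //=; apply: eq_bigr => w _.
transitivity (\sum_(w' | eqv t w w') X w / n w * f w * 1).
  rewrite -mulr_sumr -/(atom_sum t (fun=> 1) w) -/n.
  by field; rewrite gt_eqF // atom_sum1_gt0.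
apply: eq_big => [u|u]; first by rewrite eqv_sym.
by move=> wu; rewrite mulr1 /n (mX _ _ wu) (atom_sum_meas _ _ tT _ _ wu).
Qed.

Lemma eq_sum_atoms t (X f g : Omega -> R) : (t <= T)%N -> measurable_t eqv t X ->
  atom_sum t f =1 atom_sum t g -> \sum_w X w * f w = \sum_w X w * g w.
Proof.
move=> tT mX fg; rewrite (sum_atoms t) // [RHS](sum_atoms t) //.
by apply: eq_bigr => w _; rewrite fg.
Qed.

(** The indicator of an atom of [F_s] is [F_t]-measurable, so a sum over that atom depends only on
    the sums over the atoms of [F_t]. *)
Lemma atom_sum_tower s t f g : (s <= t <= T)%N ->
  atom_sum t f =1 atom_sum t g -> atom_sum s f =1 atom_sum s g.
Proof.
move=> st fg w; have /andP[st' tT] := st.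
have E h : atom_sum s h w = \sum_u (eqv s w u)%:R * h u.
  rewrite /atom_sum big_mkcond; apply: eq_bigr => u _.
  by case: ifP; rewrite ?mul1r ?mul0r.
rewrite !E; apply: (eq_sum_atoms t) => // u v uv; congr (_%:R).
have sT := leq_trans st' tT.
rewrite ![eqv s w _]eqv_sym //; congr nat_of_bool.
by apply: (eqv_left s u v sT); apply: eqv_le uv.
Qed.

End Filtration.

(** * The hedging cone, its dual and trading strategies *)

Section Market.
Context {R : realType} {Omega : finType} {d : nat}.
Variables (T : nat) (eqv : nat -> rel Omega).
Variable pi : nat -> Omega -> 'I_d -> 'I_d -> R.
Hypothesis filt : filtration T eqv.
Hypothesis rates : exch_rates T eqv pi.

(** The index consists of a time, a point representing an atom and a generator of the solvency cone
    there; the process is that generator on the atom and zero elsewhere. *)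
Definition hedge_gen (c : 'I_T.+1 * Omega * ('I_d + 'I_d * 'I_d))
    (x : Omega * 'I_d) : R :=
  (eqv c.1.1 c.1.2 x.1)%:R * gvec pi c.1.1 c.1.2 c.2 x.2.

Definition numeraire (j : 'I_d) (x : Omega * 'I_d) : R := (x.2 == j)%:R.

(** For [z = Q S_T] the martingale property makes this the [Q]-mass of the atom times [S_t]. *)
Definition atom_price t (z : Omega * 'I_d -> R) (w : Omega) (i : 'I_d) : R :=
  atom_sum eqv t (fun u => z (u, i)) w.

Lemma dot_pair (z v : Omega * 'I_d -> R) :
  dot z v = \sum_i \sum_w v (w, i) * z (w, i).
Proof.
rewrite exchange_big pair_bigA /=; apply: eq_bigr => -[w i] _.
by rewrite mulrC.
Qed.

Lemma dot_numeraire z j : dot z (numeraire j) = \sum_w z (w, j).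
Proof.
rewrite dot_pair (bigD1 j) //= [X in _ + X]big1 ?addr0.
  by apply: eq_bigr => w _; rewrite /numeraire eqxx mul1r.
move=> i /negbTE ij; rewrite big1 // => w _.
by rewrite /numeraire /= ij mul0r.
Qed.

Lemma dot_hedge_gen z t w c :
  dot z (hedge_gen (t, w, c)) = dotv (atom_price t z w) (gvec pi t w c).
Proof.
rewrite dot_pair; apply: eq_bigr => i _; rewrite mulr_suml [RHS]big_mkcond.
apply: eq_bigr => u _; rewrite /hedge_gen /=.
by case: (eqv _ _ _); rewrite ?mul1r ?mul0r // mulrC.
Qed.

Lemma dual_hedgeP z :
  dual hedge_gen z <->
  forall t w, (t <= T)%N -> price_vec pi t w (atom_price t z w).
Proof.
split=> [zg t w tT|zp [[t w] c]].
  apply/price_vec_gvec => c.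
  by have := zg ((Ordinal (tT : (t < T.+1)%N), w), c); rewrite dot_hedge_gen.
rewrite dot_hedge_gen; move: c; apply/price_vec_gvec.
by apply: zp; rewrite -ltnS.
Qed.

Lemma dual_ge0 z x : dual hedge_gen z -> 0 <= z x.
Proof.
case: x => w i /dual_hedgeP /(_ T w (leqnn T)) [/(_ i)].
by rewrite /atom_price atom_sumT.
Qed.

Lemma dual_inKt z t k : dual hedge_gen z -> (t <= T)%N -> inKt eqv pi t k ->
  0 <= dot z (fun x => k x.1 x.2).
Proof.
move=> /dual_hedgeP zp tT [km kK]; rewrite dot_pair /=.
under eq_bigr => i _.
  rewrite (sum_atoms T eqv filt t) //; last by move=> w w' /km ->.
  over.
rewrite exchange_big; apply: sumr_ge0 => w _ /=.
under eq_bigr do rewrite mulrA.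
rewrite -mulr_suml; apply: mulr_ge0; last first.
  by rewrite invr_ge0 atom_sum_ge0.
have /price_vecP /(_ _ (kK w)) := zp t w tT.
by congr (_ <= _); apply: eq_bigr => i _; rewrite mulrC.
Qed.

(** Farkas' lemma reduces membership to the sign of pairings with dual elements, so no conic
    coefficients have to be chosen. *)
Lemma cone_inKt_sum (k : nat -> Omega -> 'I_d -> R) v :
  (forall t, (t <= T)%N -> inKt eqv pi t (k t)) ->
  (forall x, v x = \sum_(t < T.+1) k t x.1 x.2) -> cone hedge_gen v.
Proof.
move=> kK vE; have [//|[z zg]] := farkas hedge_gen v.
rewrite (eq_dot z z _ (fun x => \sum_(t < T.+1) 1 * k t x.1 x.2)) //; last first.
  by move=> x; rewrite vE; apply: eq_bigr => t _; rewrite mul1r.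
rewrite (dot_sumr z (fun=> 1) (fun (t : 'I_T.+1) x => k t x.1 x.2)) ltNge sumr_ge0 //.
by move=> t _; rewrite mul1r (dual_inKt z t) //; [|apply: kK]; rewrite -ltnS.
Qed.

(** Generators are grouped by time. Those active at [w] are represented by points of its atom, and
    measurability of the exchange rates places them in the solvency cone at [w]. *)
Lemma cone_inKt_decomp v : cone hedge_gen v ->
  exists k : nat -> Omega -> 'I_d -> R,
    (forall t, (t <= T)%N -> inKt eqv pi t (k t)) /\
    forall x, v x = \sum_(t < T.+1) k t x.1 x.2.
Proof.
move=> [lam lam0 vE].
pose k t w i := \sum_(w' | eqv t w w') \sum_c
  lam ((inord t : 'I_T.+1), w', c) * gvec pi t w' c i.
exists k; split=> [t tT|[w i]].
  split=> [w w' ww'|w].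
    by apply: funext => i; apply: eq_bigl; apply: (eqv_left T).
  apply: (inK_sum pi t w (index_enum Omega) (eqv t w)
    (fun w' i => \sum_c lam ((inord t : 'I_T.+1), w', c) * gvec pi t w' c i)).
  move=> w' ww'.
  apply: (inK_sum pi t w _ predT
    (fun c i => lam ((inord t : 'I_T.+1), w', c) * gvec pi t w' c i)).
  move=> c _; apply: inKZ => //.
  have := gvec_inK pi t w c; apply: eq_inK => l.
  by have [m _ _] := rates t tT; rewrite /gvec (m _ _ ww').
rewrite vE.
transitivity (\sum_(t < T.+1) \sum_w' \sum_c
    lam (t, w', c) * hedge_gen (t, w', c) (w, i)).
  by rewrite !pair_bigA; apply: eq_bigr => -[[t w'] c].
apply: eq_bigr => t _; rewrite /k [RHS]big_mkcond; apply: eq_bigr => w' _.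
rewrite /hedge_gen /= inord_val (eqv_sym T eqv filt) -1?ltnS //.
case: ifP => _.
  by apply: eq_bigr => c _; rewrite mul1r.
by rewrite big1 // => c _; rewrite mul0r mulr0.
Qed.

Lemma cone_strategy (f : nat -> Omega -> 'I_d -> R) v m j :
  (forall t, (t <= T)%N -> measurable_t eqv t (f t)) ->
  (forall x, v x = \sum_(t < T.+1) f t x.1 x.2) ->
  cone hedge_gen (fun x => v x - m * numeraire j x) ->
  exists y, [/\ strategy T eqv y,
    (forall w i, y 0%N w i = if i == j then - m else 0) &
    forall t, (t <= T)%N ->
      inKt eqv pi t (fun w i => y t w i + f t w i - y t.+1 w i)].
Proof.
move=> fm vE /cone_inKt_decomp [k [kK kE]].
(* The recursion [y_{t+1} = y_t + f_t - k_t] forces these partial sums, and the decomposition of the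
   target makes them vanish at [T.+1]. *)
pose s t w i := (if i == j then - m else 0) + \sum_(u < t) (f u w i - k u w i).
pose y t w i := if t == T.+1 then 0 else s t w i.
have sT w i : s T.+1 w i = 0.
  have := kE (w, i); rewrite /s sumrB vE /= => <-.
  rewrite /numeraire /=; case: eqP => _; rewrite ?mulr1 ?mulr0; ring.
have yE t w i : y t w i = s t w i by rewrite /y; case: eqP => [->|].
exists y; split=> [|w i|t tT].
- split=> [w w'|t /andP[t0 tT] w w' ww'|w].
  + by apply: funext => i; rewrite !yE /s !big_ord0.
  + apply: funext => i; rewrite !yE /s; congr (_ + _); apply: eq_bigr => u _.
    have ut : (u <= t.-1)%N by rewrite -ltnS prednK.
    have uT : (u <= T)%N by rewrite (leq_trans ut) // (leq_trans (leq_pred _)).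
    have uww' : eqv u w w'.
      apply: (eqv_le T eqv filt _ t.-1) ww'.
      by rewrite ut (leq_trans (leq_pred _)).
    by have [mk _] := kK u uT; rewrite (fm u uT _ _ uww') (mk _ _ uww').
  + by apply: funext => i; rewrite /y eqxx.
- by rewrite yE /s big_ord0 addr0.
have -> : (fun w i => y t w i + f t w i - y t.+1 w i) = k t; last exact: kK.
apply: funext => w; apply: funext => i.
by rewrite !yE /s big_ord_recr /=; ring.
Qed.

Lemma strategy_cone (f y : nat -> Omega -> 'I_d -> R) v m j :
  (forall x, v x = \sum_(t < T.+1) f t x.1 x.2) ->
  strategy T eqv y ->
  (forall w i, y 0%N w i = if i == j then - m else 0) ->
  (forall t, (t <= T)%N ->
    inKt eqv pi t (fun w i => y t w i + f t w i - y t.+1 w i)) ->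
  cone hedge_gen (fun x => v x - m * numeraire j x).
Proof.
move=> vE [_ _ yT] y0 yK; apply: (cone_inKt_sum _ _ yK) => -[w i] /=.
under eq_bigr do rewrite addrAC -opprB addrC.
rewrite sumrB vE /= -(big_mkord predT (fun t => y t.+1 w i - y t w i)).
rewrite telescope_sumr // yT y0 /numeraire /=.
by case: eqP => _; rewrite ?mulr1 ?mulr0; ring.
Qed.


Lemma cone_dominated j v : exists m,
  cone hedge_gen (fun x => v x - m * numeraire j x).
Proof.
(* One unit of asset [i] costs [pi 0 w j i] units of asset [j] at time 0; the sum pays for [|v x|]
   units for every coordinate [x]. *)
exists (- \sum_x `|v x| * pi 0%N x.1 j x.2).
set N := \sum_x _.
have [//|[z zg]] := farkas hedge_gen (fun x => v x - - N * numeraire j x).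
rewrite (eq_dot z z _ (fun x => v x + N * numeraire j x)) //; last first.
  by move=> x; rewrite mulNr opprK.
rewrite dotDZr ltNge => /negP [].
rewrite /N mulr_suml -big_split; apply: sumr_ge0 => -[w i] _ /=.
have zx : z (w, i) <= pi 0%N w j i * dot z (numeraire j).
  have /dual_hedgeP /(_ 0%N w (leq0n T)) [_ /(_ j i)] := zg.
  rewrite /atom_price !(atom_sum0 T) // dot_numeraire; apply: le_trans.
  rewrite (bigD1 w) //= lerDl; apply: sumr_ge0 => u _; exact: dual_ge0.
rewrite -mulrA; apply: (@le_trans _ _ (z (w, i) * v (w, i) + `|v (w, i)| * z (w, i))).
  rewrite [X in _ + X]mulrC -mulrDr mulr_ge0 ?dual_ge0 // -lerBlDl sub0r.
  by rewrite -normrN ler_norm.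
by rewrite lerD2l ler_wpM2l.
Qed.

(** * Positive dual elements from the absence of arbitrage *)

Hypothesis no_arb : no_arbitrage T eqv pi.

(** Without such a [z], Farkas' lemma would put minus the unit claim at [(w, j)] into the cone, and
    a strategy delivering that claim from zero capital is an arbitrage. *)
Lemma dual_pos_at j w : exists2 z, dual hedge_gen z & 0 < z (w, j).
Proof.
have [hedge|[z zg zw]] := farkas hedge_gen (fun x => - (x == (w, j))%:R).
  exfalso; apply: no_arb.
  pose x u i : R := ((u, i) == (w, j))%:R.
  (* The claim is withdrawn only at [T], where atoms are single points and it is therefore
     measurable. *)
  pose f t u i := if t == T then - x u i else 0.
  have fE y : - (y == (w, j))%:R = \sum_(t < T.+1) f t y.1 y.2.
    rewrite big_ord_recr big1 /= => [|t _]; last by rewrite /f ltn_eqF.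
    by rewrite add0r /f eqxx /x -surjective_pairing.
  have fm t : (t <= T)%N -> measurable_t eqv t (f t).
    rewrite leq_eqVlt => /orP[/eqP-> u u'|/ltn_eqF tT u u' _].
      by rewrite (eqvT _ _ filt) => /eqP->.
    by apply: funext => i; rewrite /f tT.
  have [|y [ys y0 yK]] := cone_strategy f _ 0 j fm fE.
    by have -> : (fun y : Omega * 'I_d => - (y == (w, j))%:R - 0 * numeraire j y)
      = (fun y => - (y == (w, j))%:R) by apply: funext => y; rewrite mul0r subr0.
  exists y, x; split=> [|t tT|u i||].
  - by split=> // u i; rewrite y0 oppr0 if_same.
  - have := yK t (ltnW tT); congr inKt; apply: funext => u; apply: funext => i.
    by rewrite /f ltn_eqF // addr0.
  - exact: ler0n.
  - by exists w, j; rewrite /x eqxx oner_neq0.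
  have := yK T (leqnn T); congr inKt; apply: funext => u; apply: funext => i.
  by have [_ _ ->] := ys; rewrite /f eqxx subr0.
exists z => //; move: zw; rewrite /dot (bigD1 (w, j)) //= eqxx mulrN1 big1 ?addr0.
  by rewrite oppr_lt0.
by move=> x /negbTE ->; rewrite oppr0 mulr0.
Qed.

Lemma dual_pos j : exists2 z, dual hedge_gen z & forall w, 0 < z (w, j).
Proof.
have /choice [Z ZP] w : exists z, dual hedge_gen z /\ 0 < z (w, j).
  by have [z] := dual_pos_at j w; exists z.
exists (fun x => \sum_w 1 * Z w x) => [c|w].
  rewrite dotC (dot_sumr _ (fun=> 1)); apply: sumr_ge0 => w _.
  by rewrite mul1r dotC; have [] := ZP w.
rewrite (bigD1 w) //= mul1r; have [_ Zw] := ZP w.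
apply: ltr_wpDr => //; apply: sumr_ge0 => u _; rewrite mul1r.
by apply: dual_ge0; have [] := ZP u.
Qed.

End Market.

(** * Pricing pairs as dual elements, and the optimal stopping time *)

Section Duality.
Context {R : realType} {Omega : finType} {d : nat}.
Variables (T : nat) (eqv : nat -> rel Omega) (P : Omega -> R).
Variable pi : nat -> Omega -> 'I_d -> 'I_d -> R.
Variables (xi : nat -> Omega -> 'I_d -> R) (j : 'I_d).
Hypothesis filt : filtration T eqv.
Hypothesis prob : full_prob P.
Hypothesis rates : exch_rates T eqv pi.
Hypothesis no_arb : no_arbitrage T eqv pi.
Hypothesis amer : american T eqv xi.

Local Notation G := (hedge_gen T eqv pi).
Local Notation price := (atom_price eqv).
Local Notation Pb := (Pbar T eqv P pi j).

Definition payoff (chi : nat -> Omega -> R) (x : Omega * 'I_d) : R :=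
  \sum_(t < T.+1) chi t x.1 * xi t x.1 x.2.

(** Since [chi_t xi_t] is [F_t]-measurable, the term at time [t] sees [z] only through its atom
    sums, which are those of [Q S_t]. *)
Lemma expQ_dot Q S chi z :
  (forall t, (t <= T)%N -> measurable_t eqv t (chi t)) ->
  (forall t, (t <= T)%N -> measurable_t eqv t (S t)) ->
  (forall t w i, (t <= T)%N -> price t z w i = atom_sum eqv t Q w * S t w i) ->
  expQ T Q xi S chi = dot z (payoff chi).
Proof.
move=> chim Sm zE; rewrite dot_pair exchange_big /expQ.
transitivity (\sum_w \sum_(t < T.+1) \sum_i (chi t w * xi t w i) * (Q w * S t w i)).
  apply: eq_bigr => w _; rewrite mulr_sumr; apply: eq_bigr => t _.
  rewrite /dotv mulrA mulr_sumr; apply: eq_bigr => i _; ring.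
transitivity (\sum_w \sum_(t < T.+1) \sum_i (chi t w * xi t w i) * z (w, i)).
  rewrite exchange_big [RHS]exchange_big; apply: eq_bigr => t _ /=.
  have tT : (t <= T)%N by rewrite -ltnS.
  rewrite exchange_big [RHS]exchange_big; apply: eq_bigr => i _ /=.
  apply: (eq_sum_atoms T eqv filt t) => // [w w' ww'|w].
    by rewrite (chim t tT _ _ ww') (amer t tT _ _ ww').
  rewrite atom_sum_measM //; first by rewrite -zE.
  move=> u u' uu'.
  by rewrite (Sm t tT _ _ uu').
apply: eq_bigr => w _; rewrite exchange_big; apply: eq_bigr => i _.
by rewrite mulr_suml.
Qed.

(** Backward induction over the times [T - k]: at [T] atoms are single points, and the martingale
    property gives each step to the coarser atoms. *)
Lemma Pbar_price Q S : Pb Q S ->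
  forall t w i, (t <= T)%N ->
    price t (fun x => Q x.1 * S T x.1 x.2) w i = atom_sum eqv t Q w * S t w i.
Proof.
case=> _ _ [Sm mart] _ _ t w i tT; rewrite -(subKn tT).
elim: (T - t)%N w => [|k IH] w.
  by rewrite subn0 /atom_price !(atom_sumT _ _ filt).
(* Once [k] reaches [T], truncated subtraction keeps the time at 0 and the induction hypothesis is
   already the claim. *)
have [Tk|kT] := leqP T k.
  have e : (T - k.+1 = T - k)%N.
    by rewrite subnS; move: Tk; rewrite -subn_eq0 => /eqP ->.
  by rewrite e IH.
have e : (T - k = (T - k.+1).+1)%N by rewrite subnS prednK // subn_gt0.
set s := (T - k.+1)%N in e *; rewrite e in IH.
have sT : (s < T)%N by rewrite -e leq_subr.
rewrite -[RHS]mart // -/(atom_sum eqv s (fun u => Q u * S s.+1 u i) w).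
apply: (atom_sum_tower T eqv filt s s.+1); first by rewrite leqnSn.
move=> u; rewrite [RHS]atom_sum_measM; first exact: IH.
by move=> v v' vv'; rewrite (Sm _ sT _ _ vv').
Qed.

Lemma Pbar_dual Q S : Pb Q S -> exists z, [/\ dual G z, dot z (numeraire j) = 1 &
  forall chi, mixed_stop T eqv chi -> expQ T Q xi S chi = dot z (payoff chi)].
Proof.
move=> QS; have zE := Pbar_price _ _ QS.
have [[Q0 Q1] _ [Sm _] SK Sj] := QS.
exists (fun x => Q x.1 * S T x.1 x.2); split=> [||chi [chim _ _]].
- apply/(dual_hedgeP T eqv pi) => t w tT.
  have -> : price t (fun x => Q x.1 * S T x.1 x.2) w =
            fun i => atom_sum eqv t Q w * S t w i.
    by apply: funext => i; rewrite zE.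
  apply: price_vecZ; first exact: atom_sum_ge0.
  by apply/price_vecP; have [] := SK t w tT.
- by rewrite dot_numeraire -Q1; apply: eq_bigr => w _; rewrite Sj // mulr1.
exact: expQ_dot.
Qed.

(* On [Q]-null atoms the whole price vector of [z] vanishes, and any consistent
   price vector may be used for [S]; it comes from the positive [z0]. *)
Lemma dual_Pbar z : dual G z -> dot z (numeraire j) = 1 ->
  exists Q S, Pb Q S /\
    forall chi, mixed_stop T eqv chi -> expQ T Q xi S chi = dot z (payoff chi).
Proof.
move=> zG z1; have [z0 z0G z0j] := dual_pos T eqv pi filt rates no_arb j.
have zp := (dual_hedgeP T eqv pi z).1 zG.
have z0p := (dual_hedgeP T eqv pi z0).1 z0G.
have z0pos t w : (t <= T)%N -> 0 < price t z0 w j.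
  move=> tT; rewrite /atom_price /atom_sum (bigD1 w) ?(eqv_refl T) //=.
  by apply: ltr_wpDr => //; apply: sumr_ge0 => u _; apply: ltW.
(* As [S^j] is to be 1, component [j] of [z = Q S_T] must be [Q] itself. *)
pose Q w := z (w, j).
pose zz t w := if price t z w j == 0 then z0 else z.
pose S t w i := (price t (zz t w) w j)^-1 * price t (zz t w) w i.
have priceQ t w : price t z w j = atom_sum eqv t Q w by [].
have zzj t w : (t <= T)%N -> price t (zz t w) w j != 0.
  by move=> tT; rewrite /zz; case: ifP => [_|/negbT //]; rewrite gt_eqF ?z0pos.
have zzp t w : (t <= T)%N -> price_vec pi t w (price t (zz t w) w).
  by move=> tT; rewrite /zz; case: ifP => _; [apply: z0p | apply: zp].
have QS t w i : (t <= T)%N -> price t z w i = atom_sum eqv t Q w * S t w i.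
  move=> tT; rewrite -priceQ /S /zz; case: eqVneq => [zj|zj].
    by rewrite zj mul0r (price_vec0 pi t w _ j (zp t w tT)).
  by rewrite mulrA divff ?mul1r.
have Sm t : (t <= T)%N -> measurable_t eqv t (S t).
  move=> tT w w' ww'; have pE y i : price t y w i = price t y w' i.
    exact: (atom_sum_meas T eqv filt t _ tT).
  by apply: funext => i; rewrite /S /zz !pE.
exists Q, S; split; last by move=> chi [chim _ _]; apply: expQ_dot.
split.
- split=> [w|]; first by apply: (dual_ge0 T eqv pi filt).
  by rewrite -z1 dot_numeraire.
- by move=> w Pw; have := prob.1 w; rewrite Pw ltxx.
- split=> [|t w i tT]; first exact: Sm.
  (* Both sides of the martingale identity are the atom sum of [z] at time [t], computed through
     time [t.+1] and directly. *)
  transitivity (price t z w i); last exact: (QS t w i (ltnW tT)).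
  apply: (atom_sum_tower T eqv filt t t.+1); first by rewrite leqnSn.
  move=> u; rewrite atom_sum_measM; first by rewrite -(QS _ u i tT).
  by move=> v v' vv'; rewrite (Sm _ tT _ _ vv').
- move=> t w tT; split.
    apply/price_vecP; apply: price_vecZ; last exact: zzp.
    by rewrite invr_ge0; case: (zzp t w tT).
  by exists j; rewrite /S mulVf ?oner_neq0 // zzj.
by move=> t w tT; rewrite /S mulVf // zzj.
Qed.

Lemma hedge_le_dual z v m : dual G z -> dot z (numeraire j) = 1 ->
  cone G (fun x => v x - m * numeraire j x) -> m <= dot z v.
Proof.
move=> zG z1 /(dot_cone_ge0 _ _ _ zG).
rewrite (eq_dot z z _ (fun x => v x + (- m) * numeraire j x)) //.
  by rewrite dotDZr z1 mulr1 subr_ge0.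
by move=> x; rewrite mulNr.
Qed.

Lemma dual_nonempty : exists2 z, dual G z & dot z (numeraire j) = 1.
Proof.
have [z zG zj] := dual_pos T eqv pi filt rates no_arb j.
(* Total mass 1 excludes an empty [Omega], on which the normalising constant would be zero. *)
have [w _] : exists w : Omega, true.
  have [_ P1] := prob; have := oner_neq0 R; rewrite -P1 => P_neq0.
  have [/existsP //|] := boolP [exists w : Omega, true].
  rewrite negb_exists => /forallP O0; case/eqP: P_neq0.
  by rewrite big1 // => w _; have := O0 w.
have z1 : 0 < dot z (numeraire j).
  rewrite dot_numeraire (bigD1 w) //=.
  by apply: ltr_wpDr => //; apply: sumr_ge0 => u _; apply: ltW.
exists (fun x => (dot z (numeraire j))^-1 * z x).
  by move=> c; rewrite dotZl mulr_ge0 // invr_ge0 ltW.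
by rewrite dotZl mulVf // gt_eqF.
Qed.

(** [M] is the largest hedgeable value. A dual optimiser prices the payoff at no more than [M] and
    becomes a pair in [Pbar]; weak duality gives the reverse inequality for every pair. *)
Lemma hedging_duality chi : mixed_stop T eqv chi -> exists M Q S,
  [/\ cone G (fun x => payoff chi x - M * numeraire j x), Pb Q S,
      expQ T Q xi S chi = M &
      forall Q' S', Pb Q' S' -> M <= expQ T Q' xi S' chi].
Proof.
move=> chiX; have [z zG z1] := dual_nonempty.
have [m0 hm0] := cone_dominated T eqv pi filt j (payoff chi).
have [M hM maxM] := cone_max G _ _ m0 _ hm0 (fun m => hedge_le_dual z _ m zG z1).
have weak Q S : Pb Q S -> M <= expQ T Q xi S chi.
  by move=> /Pbar_dual [z' [z'G z'1 ->//]]; apply: hedge_le_dual.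
have [y yG [y1 yM]] := cone_max_dual G _ _ M hM maxM.
have [Q [S [QS QSE]]] := dual_Pbar y yG y1.
exists M, Q, S; split=> //; apply/eqP.
by rewrite eq_le weak // andbT QSE.
Qed.

(* The last [Omega] coordinates record [\sum_t chi_t], so that the mixed
   stopping time becomes part of the conic combination. *)
Definition stop_gen (c : 'I_T.+1 * Omega * ('I_d + 'I_d * 'I_d) + 'I_T.+1 * Omega)
    (x : Omega * 'I_d + Omega) : R :=
  match c, x with
  | inl c, inl x => G c x
  | inl _, inr _ => 0
  | inr (t, w), inl x => - ((eqv t x.1 w)%:R * xi t x.1 x.2)
  | inr (t, w), inr w' => (eqv t w' w)%:R
  end.

Definition stop_target (x : Omega * 'I_d + Omega) : R :=
  if x is inr _ then 1 else 0.

Definition stop_numeraire (x : Omega * 'I_d + Omega) : R :=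
  if x is inl x then numeraire j x else 0.

(** The coordinates in [Omega] make the stopping weights sum to one; the minus sign in the other
    coordinates carries the payoff to the left-hand side. *)
Lemma stop_coneP m :
  cone stop_gen (fun x => stop_target x - m * stop_numeraire x) <->
  exists2 chi, mixed_stop T eqv chi &
    cone G (fun x => payoff chi x - m * numeraire j x).
Proof.
split=> [[lam lam0 lamE]|[chi [chim chi01 chi1] [lam lam0 lamE]]].
  pose chi t w := \sum_(w' | eqv t w w') lam (inr ((inord t : 'I_T.+1), w')).
  have chiE (t : 'I_T.+1) w : chi t w =
      \sum_w' lam (inr (t, w')) * (eqv t w w')%:R.
    rewrite /chi big_mkcond; apply: eq_bigr => w' _; rewrite inord_val.
    by case: ifP; rewrite ?mulr1 ?mulr0.
  have chi0 t w : 0 <= chi t w by apply: sumr_ge0.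
  have chi1 w : \sum_(t < T.+1) chi t w = 1.
    have := lamE (inr w); rewrite /= mulr0 subr0 big_sumType /= => ->.
    rewrite [X in _ = X + _]big1 ?add0r => [|c _]; last by rewrite mulr0.
    under eq_bigr do rewrite chiE.
    by rewrite pair_bigA; apply: eq_bigr => -[t w'].
  exists chi.
    split=> [t tT|t w tT|//]; first exact: (atom_sum_meas T eqv filt).
    rewrite chi0 /= -(chi1 w) (bigD1 (Ordinal (tT : (t < T.+1)%N))) //=.
    by rewrite lerDl; apply: sumr_ge0.
  exists (fun c => lam (inl c)) => // x.
  have := lamE (inl x); rewrite /= sub0r big_sumType /= => ->.
  set s := (X in _ + (_ + X) = _).
  suff -> : s = - payoff chi x by rewrite addrC subrK.
  rewrite /payoff -sumrN.
  under [RHS]eq_bigr do rewrite chiE mulr_suml -sumrN.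
  rewrite [RHS]pair_bigA; apply: eq_bigr => -[t w'] _ /=; ring.
(* All points of an atom represent the same generator, so the value of [chi] is shared equally among
   them. *)
pose u (c : 'I_T.+1 * Omega) := chi c.1 c.2 / atom_sum eqv c.1 (fun=> 1) c.2.
exists (fun c => match c with inl c => lam c | inr c => u c end).
  move=> [c|[t w]] //; rewrite mulr_ge0 ?invr_ge0 ?atom_sum_ge0 //.
  by have /andP[] := chi01 t w (ltn_ord t).
have chiE (t : 'I_T.+1) w : chi t w =
    \sum_w' chi t w' / atom_sum eqv t (fun=> 1) w' * (eqv t w w')%:R.
  have tT : (t <= T)%N by rewrite -ltnS.
  transitivity (\sum_(w' | eqv t w w') chi t w / atom_sum eqv t (fun=> 1) w * 1).
    rewrite -mulr_sumr -/(atom_sum eqv t (fun=> 1) w) divfK //.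
    by rewrite gt_eqF // (atom_sum1_gt0 T).
  rewrite big_mkcond; apply: eq_bigr => w' _.
  case: ifP => [ww'|_]; last by rewrite mulr0.
  by rewrite (chim t tT _ _ ww') (atom_sum_meas T eqv filt t _ tT _ _ ww').
move=> [x|w]; rewrite big_sumType /=.
  rewrite -lamE; set r := (X in _ = _ + X).
  suff -> : r = - payoff chi x by rewrite [RHS]addrAC subrr.
  rewrite /payoff -sumrN.
  under [RHS]eq_bigr do rewrite chiE mulr_suml -sumrN.
  rewrite [RHS]pair_bigA; apply: eq_bigr => -[t w'] _; by rewrite mulrN mulrA.
rewrite big1 => [|c _]; last by rewrite mulr0.
rewrite mulr0 subr0 add0r; transitivity (\sum_(t < T.+1) chi t w); first by rewrite chi1.
under [LHS]eq_bigr do rewrite chiE.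
by rewrite [LHS]pair_bigA; apply: eq_bigr => -[t w'].
Qed.

Lemma mixed_stop_exists : exists chi : nat -> Omega -> R, mixed_stop T eqv chi.
Proof.
exists (fun t _ => (t == 0%N)%:R); split=> // [t w _|w].
  by case: eqP; rewrite ?ler01 ?lexx.
by rewrite big_ord_recl big1 ?addr0.
Qed.

Lemma optimal_stop : exists chi M, [/\ mixed_stop T eqv chi,
  cone G (fun x => payoff chi x - M * numeraire j x) &
  forall chi' m, mixed_stop T eqv chi' ->
    cone G (fun x => payoff chi' x - m * numeraire j x) -> m <= M].
Proof.
have [z zG z1] := dual_nonempty.
have [chi0 chi0X] := mixed_stop_exists.
have [m0 hm0] := cone_dominated T eqv pi filt j (payoff chi0).
have {}hm0 : cone stop_gen (fun x => stop_target x - m0 * stop_numeraire x).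
  by apply/stop_coneP; exists chi0.
(* Since [z] is nonnegative and [chi] takes values in [[0,1]], this bounds the pairing of [z] with
   the payoff uniformly in [chi]. *)
pose B := \sum_x z x * \sum_(t < T.+1) `|xi t x.1 x.2|.
have [|M /stop_coneP [chi chiX hM] maxM] := cone_max stop_gen _ _ m0 B hm0.
  move=> m /stop_coneP [chi [_ chi01 _]] /(hedge_le_dual z _ m zG z1) mz.
  apply: le_trans mz _; apply: ler_sum => x _.
  rewrite ler_wpM2l ?(dual_ge0 T eqv pi filt) //; apply: ler_sum => t _.
  have /andP[c0 c1] := chi01 t x.1 (ltn_ord t).
  apply: le_trans (ler_norm _) _; rewrite normrM ler_piMl // ger0_norm //.
exists chi, M; split=> // chi' m chi'X hm.
by apply: maxM; apply/stop_coneP; exists chi'.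
Qed.

Lemma Phi_bgP chi m : mixed_stop T eqv chi ->
  (exists2 y, Phi_bg T eqv pi xi y chi &
     forall w i, y 0%N w i = if i == j then - m else 0) <->
  cone G (fun x => payoff chi x - m * numeraire j x).
Proof.
move=> chiX; split=> [[y [ys _ yK] y0]|hedge].
  exact: (strategy_cone T eqv pi filt (fun t w i => chi t w * xi t w i) y).
have [t tT w w' ww'|//|y [ys y0 yK]] := cone_strategy T eqv pi filt rates
  (fun t w i => chi t w * xi t w i) _ m j _ _ hedge.
  by have [chim _ _] := chiX; rewrite (chim t tT _ _ ww') (amer t tT _ _ ww').
by exists y.
Qed.

End Duality.

(** * Extended-real extrema and the proof of the theorem *)

Lemma ereal_sup_eq_max {R : realType} (A : set (\bar R)) M :
  A M -> ubound A M -> ereal_sup A = M.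
Proof.
move=> AM ubM; apply/eqP; rewrite eq_le ge_ereal_sup //=.
exact: ereal_sup_ubound.
Qed.

Lemma ereal_inf_eq_min {R : realType} (A : set (\bar R)) M :
  A M -> lbound A M -> ereal_inf A = M.
Proof.
move=> AM lbM; apply/eqP; rewrite eq_le le_ereal_inf_tmp // andbT.
exact: ereal_inf_lbound.
Qed.

Theorem theorem5p6 (R : realType) (Omega : finType) (T d : nat)
    (eqv : nat -> rel Omega) (P : Omega -> R)
    (pi : nat -> Omega -> 'I_d -> 'I_d -> R)
    (xi : nat -> Omega -> 'I_d -> R) (j : 'I_d) :
  filtration T eqv -> full_prob P -> exch_rates T eqv pi ->
  no_arbitrage T eqv pi -> american T eqv xi ->
  (* for every mixed stopping time the inner minimum is attained *)
  (forall chi, mixed_stop T eqv chi ->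
     exists Q S, Pbar T eqv P pi j Q S /\
       forall Q' S', Pbar T eqv P pi j Q' S' ->
         expQ T Q xi S chi <= expQ T Q' xi S' chi) /\
  (* pi^bg_j(xi) = sup_chi min_{(Q,S)} E_Q((xi.S)_chi) *)
  pi_bg T eqv pi xi j =
    ereal_sup [set v : \bar R | exists chi, mixed_stop T eqv chi /\
       v = ereal_inf [set u : \bar R | exists Q S,
                        Pbar T eqv P pi j Q S /\ u = (expQ T Q xi S chi)%:E]] /\
  (* saddle point: the sup is a max, attained at chi_hat *)
  (exists chi_hat Q_hat S_hat,
     [/\ mixed_stop T eqv chi_hat, Pbar T eqv P pi j Q_hat S_hat,
         pi_bg T eqv pi xi j = (expQ T Q_hat xi S_hat chi_hat)%:E &
         forall Q S, Pbar T eqv P pi j Q S ->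
           expQ T Q_hat xi S_hat chi_hat <= expQ T Q xi S chi_hat]).
Proof.
move=> filt prob rates no_arb amer.
have dua := hedging_duality T eqv P pi xi j filt prob rates no_arb amer.
have PhiP := Phi_bgP T eqv pi xi j filt rates amer.
have [chi [M [chiX hM maxM]]] :=
  optimal_stop T eqv P pi xi j filt prob rates no_arb.
have infE chi' m Q S : Pbar T eqv P pi j Q S -> expQ T Q xi S chi' = m ->
    (forall Q' S', Pbar T eqv P pi j Q' S' -> m <= expQ T Q' xi S' chi') ->
    ereal_inf [set u : \bar R | exists Q S,
      Pbar T eqv P pi j Q S /\ u = (expQ T Q xi S chi')%:E] = m%:E.
  move=> QS QSm minm; apply: ereal_inf_eq_min; first by exists Q, S; rewrite QSm.
  by move=> _ [Q' [S' [QS' ->]]]; rewrite lee_fin minm.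
have [M' [Q [S [hM' QS QSE minM]]]] := dua chi chiX.
(* [M'] is hedgeable with [chi], hence at most [M]; conversely [M] is hedgeable with [chi], so weak
   duality bounds it by the expectation [M'] under [(Q, S)]. *)
have MM' : M' = M.
  apply/eqP; rewrite eq_le (maxM chi) //= -QSE.
  have [z [zG z1 zE]] := Pbar_dual T eqv P pi xi j filt amer _ _ QS.
  by rewrite zE //; apply: hedge_le_dual zG z1 hM.
have piE : pi_bg T eqv pi xi j = M%:E.
  apply: ereal_sup_eq_max.
    have /(PhiP _ _ chiX) [y yPhi y0] := hM.
    by exists (- M), y, chi; split=> //; rewrite opprK.
  move=> _ [x [y [chi' [yPhi y0 ->]]]]; rewrite lee_fin.
  have [_ chi'X _] := yPhi; apply: (maxM chi') => //.
  by apply/(PhiP _ _ chi'X); exists y => //; rewrite opprK.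
split; last split.
- move=> chi' /dua [m [Q' [S' [_ QS' QSE' minm]]]].
  by exists Q', S'; rewrite QSE'.
(* For each stopping time the inner infimum is its largest hedgeable value, which is at most [M] and
   equals [M] at [chi]. *)
- rewrite piE; apply/esym/ereal_sup_eq_max.
    by exists chi; split=> //; rewrite (infE _ M Q S) // -MM'.
  move=> _ [chi' [chi'X ->]].
  have [m [Q' [S' [hm QS' QSE' minm]]]] := dua _ chi'X.
  by rewrite (infE _ m Q' S') // lee_fin (maxM chi').
exists chi, Q, S; split=> //; first by rewrite piE QSE MM'.
by rewrite QSE.
Qed.
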